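(* For all integers $n\geq 0$, $m\geq 3$, and every movement digraph $D$ on the vertex set $\mathcal{M}=\{1,\ldots,m\}$, the number of arcs in the restricted Hanoi graph $H_n^m(D)$ is $$|A(H_n^m(D))|=\sum_{k=1}^{n}t_k^{n,m}(D)=\frac{1}{2}|A(D)|\bigl(m^n-(m-2)^n\bigr),$$ where $t_k^{n,m}(D)$ is the number of arcs of $H_n^m(D)$ that correspond to moves of disc $k$.
   Context: Let $\mathcal{N}=\{1,\ldots,n\}$ be the set of discs (disc $d$ is smaller than disc $d'$ when $d<d'$) and $\mathcal{M}=\{1,\ldots,m\}$ the set of pegs. A movement digraph is a digraph $D=(\mathcal{M},A(D))$ (no loops, no multiple arcs), where $(p,q)\in A(D)$ means that moving a disc from peg $p$ to peg $q$ is allowed. The restricted Hanoi graph $H_n^m(D)$ is the digraph whose vertices are all the distributions of the $n$ discs on the $m$ pegs, each written as an $n$-tuple $u=u_n\ldots u_1$ with $u_d\in\mathcal{M}$ the peg on which disc $d$ lies (on each peg the discs are stacked with smaller discs above larger ones). There is an arc $(u,v)\in A(H_n^m(D))$ if and only if $v$ is obtained from $u$ by one legal move, i.e. a move obeying: (i) exactly one disc is moved, from its peg to a different one; (ii) the disc moved is the topmost disc of its peg; (iii) a disc cannot be placed on a smaller one; and the disc is moved from a peg $p$ to a peg $q$ with $(p,q)\in A(D)$. An arc $(u,v)$ corresponds to a move of disc $k$ if $u_k\neq v_k$. *)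

(* Defs.v *)
From mathcomp Require Import all_boot.
Set Implicit Arguments.
Unset Strict Implicit.
Unset Printing Implicit Defensive.

(* Arcs form a set of ordered pairs, so there are no multiple arcs. *)
Record digraph (V : finType) := Digraph {
  arcs : {set V * V};
  arcs_loopless : forall x : V, (x, x) \notin arcs
}.

(* Discs and pegs are numbered from 0, smaller discs having smaller numbers.
   Since every peg is stacked with smaller discs above larger ones, a
   distribution is determined by the peg on which each disc lies. *)
Definition distribution (n m : nat) := {ffun 'I_n -> 'I_m}.

Definition is_top (n m : nat) (u : distribution n m) (p : 'I_m) (d : 'I_n) :=
  (u d == p) && [forall e : 'I_n, (u e == p) ==> (d <= e)].

Definition legal_move (n m : nat) (D : digraph 'I_m) (u v : distribution n m)
    (d : 'I_n) :=
  [&& [forall e : 'I_n, (u e != v e) == (e == d)],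
      is_top u (u d) d,
      [forall e : 'I_n, is_top u (v d) e ==> ~~ (e < d)]
    & (u d, v d) \in arcs D].

Definition hanoi_arcs (n m : nat) (D : digraph 'I_m) :
    {set distribution n m * distribution n m} :=
  [set a | [exists d : 'I_n, legal_move D a.1 a.2 d]].

Lemma hanoi_arcs_loopless (n m : nat) (D : digraph 'I_m)
  (u : distribution n m) : (u, u) \notin hanoi_arcs n D.
Proof.
rewrite inE; apply/existsP => -[d /and4P[/forallP/(_ d) + _ _ _]].
by rewrite /= !eqxx.
Qed.

Definition hanoi_graph (n m : nat) (D : digraph 'I_m) :
    digraph (distribution n m) :=
  Digraph (@hanoi_arcs_loopless n m D).

Definition disc_arcs (n m : nat) (D : digraph 'I_m) (k : 'I_n) : nat :=
  #|[set a in arcs (hanoi_graph n D) | a.1 k != a.2 k]|.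

(* Main.v *)
Require Import Defs.
From mathcomp Require Import all_boot all_order all_algebra.
Import GRing.Theory Num.Theory.
Local Open Scope ring_scope.

(** A move of disc [k] from peg [p] to peg [q] is possible exactly when no
    smaller disc lies on [p] or [q]: the two stacking rules forbid them there,
    and the larger discs are never in the way. Hence such a move is determined
    by the arc [(p, q)] of [D], one of [m - 2] pegs for each of the [k] smaller
    discs, and one of [m] pegs for each of the [n - 1 - k] larger ones. So disc
    [k] contributes [#|arcs D| * (m - 2)^k * m^(n - 1 - k)] arcs
    ([card_disc_arcs]). Every arc moves exactly one disc, so the total is the
    sum over [k] ([card_hanoi_arcs]), and this geometric sum is the
    factorization of [m^n - (m - 2)^n] divided by [m - (m - 2) = 2]. *)

Definition move_disc {n m : nat} (u : distribution n m) (k : 'I_n) (q : 'I_m) :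
    distribution n m :=
  [ffun e => if e == k then q else u e].

(** The rule on the target peg only speaks of its topmost disc. Were there a
    disc smaller than [d] on that peg, the smallest disc there would be topmost
    and smaller than [d]; so the rule excludes all smaller discs. *)
Lemma legal_moveE (n m : nat) (D : digraph 'I_m) (u v : distribution n m)
    (d : 'I_n) :
  legal_move D u v d =
  [&& v == move_disc u d (v d),
      [forall e : 'I_n, (e < d)%N ==> (u e \notin pred2 (u d) (v d))]
    & (u d, v d) \in arcs D].
Proof.
apply/and4P/and3P => -[].
- move=> /forallP diff /andP[_ /forallP src] /forallP tgt arc.
  split=> //.
    apply/eqP/ffunP => e; rewrite ffunE; case: eqP => [->//|/eqP ned].
    by have := diff e; rewrite (negbTE ned) => /eqP/negbFE/eqP.
  apply/forallP => e; apply/implyP => lt_ed; rewrite inE negb_or.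
  apply/andP; split.
    by apply/negP => ue; have := implyP (src e) ue; rewrite leqNgt lt_ed.
  apply/negP => ue.
  case: (@arg_minnP _ e (fun f => u f == v d) (@nat_of_ord n) ue) => f uf minf.
  have top_f : is_top u (v d) f.
    by rewrite /is_top uf; apply/forallP => g; apply/implyP/minf.
  by have := implyP (tgt f) top_f; rewrite (leq_ltn_trans (minf _ ue) lt_ed).
- move=> /eqP vE /forallP free arc.
  have neq_uv : u d != v d.
    by apply: contraTneq arc => ->; apply: arcs_loopless.
  have clear e : u e \in pred2 (u d) (v d) -> (d <= e)%N.
    by move=> ue; rewrite leqNgt; apply: contraL ue => /(implyP (free e)).
  split=> //.
  + apply/forallP => e; rewrite {1}vE ffunE.
    by case: (e =P d) => [->|_]; rewrite ?neq_uv ?eqxx.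
  + rewrite /is_top eqxx; apply/forallP => e; apply/implyP => ue.
    by apply: clear; rewrite inE ue.
  + apply/forallP => e; apply/implyP => /andP[ue _].
    by rewrite -leqNgt; apply: clear; rewrite inE ue orbT.
Qed.

Lemma legal_move_diff {n m : nat} {D : digraph 'I_m} {u v : distribution n m}
    {d : 'I_n} (e : 'I_n) :
  legal_move D u v d -> (u e != v e) = (e == d).
Proof. by case/and4P => /forallP/(_ e)/eqP. Qed.

Lemma disc_arcsE (n m : nat) (D : digraph 'I_m) (k : 'I_n) :
  disc_arcs D k = #|[set a | legal_move D a.1 a.2 k]|.
Proof.
apply: eq_card => -[u v]; rewrite !inE /=; apply/andP/idP.
  by case=> /existsP[d mv]; rewrite (legal_move_diff _ mv) => /eqP ->.
by move=> mv; rewrite (legal_move_diff _ mv) eqxx; split=> //; apply/existsP;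
  exists k.
Qed.

Lemma card_hanoi_arcs (n m : nat) (D : digraph 'I_m) :
  #|arcs (hanoi_graph n D)| = (\sum_(k < n) disc_arcs D k)%N.
Proof.
rewrite -sum1_card.
under [RHS]eq_bigr => k _.
  rewrite /disc_arcs -sum1_card.
  under eq_bigl => a do rewrite inE.
  rewrite big_mkcondr; over.
rewrite exchange_big; apply: eq_bigr => -[u v]; rewrite inE => /existsP[d mv].
under eq_bigr => k _ do rewrite (legal_move_diff _ mv).
by rewrite -big_mkcond big_pred1_eq.
Qed.

(** The positions that admit the move of disc [k] from [p] to [q] are cut out by
    an independent condition on each disc [i], namely this one; so they form a
    [family], and their number is a product over the discs. *)
Definition ready {n m : nat} (k : 'I_n) (p q : 'I_m) (i : 'I_n) : pred 'I_m :=
  if (i < k)%N then [predC pred2 p q] else if i == k then pred1 p else predT.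

Lemma card_ready (n m : nat) (k : 'I_n) (p q : 'I_m) : p != q ->
  #|[set u : distribution n m | u \in family (ready k p q)]| =
  ((m - 2) ^ k * m ^ (n - k.+1))%N.
Proof.
move=> neq_pq; rewrite cardsE card_family foldrE big_map big_enum /=.
have card_at (i : 'I_n) : #|ready k p q i| =
    (if (i < k)%N then m - 2 else if i == k :> nat then 1 else m)%N.
  rewrite /ready; case: ifP => _.
    rewrite -[in RHS](card_ord m) -(cardC (pred2 p q)).
    by rewrite card2 neq_pq addKn.
  by rewrite -val_eqE; case: ifP => _; rewrite ?card1 ?card_ord.
under eq_bigr => i _ do rewrite card_at.
rewrite -(big_mkord xpredT (fun i =>
  if (i < k)%N then m - 2 else if i == k :> nat then 1 else m)%N).
rewrite (@big_cat_nat _ _ _ k) //=; last exact: ltnW.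
rewrite (@big_ltn _ _ _ k) // ltnn eqxx mul1n; congr (_ * _)%N.
  rewrite (@eq_big_nat _ _ _ _ _ _ (fun=> (m - 2)%N)) => [|i /andP[_ ->]//].
  by rewrite prod_nat_const_nat subn0.
rewrite (@eq_big_nat _ _ _ _ _ _ (fun=> m)).
  by rewrite prod_nat_const_nat.
by move=> i /andP[lt_ki _]; rewrite ltnNge (ltnW lt_ki) gtn_eqF.
Qed.

Lemma card_disc_arcs (n m : nat) (D : digraph 'I_m) (k : 'I_n) :
  disc_arcs D k = (#|arcs D| * ((m - 2) ^ k * m ^ (n - k.+1)))%N.
Proof.
rewrite disc_arcsE -sum1_card.
rewrite (partition_big
  (fun a : distribution n m * distribution n m => (a.1 k, a.2 k))
  (mem (arcs D))) /=; last first.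
  by move=> [u v]; rewrite inE legal_moveE => /and3P[].
rewrite -sum_nat_const; apply: eq_bigr => -[p q] arc.
have neq_pq : p != q by apply: contraTneq arc => ->; apply: arcs_loopless.
rewrite -(@card_ready n m k p q neq_pq) sum1dep_card.
(* A move of [k] along [(p, q)] is determined by its starting position, so the
   two sets are compared through the graph of [move_disc]. *)
rewrite -(card_imset _ (f := fun u => (u, move_disc u k q))); last first.
  by move=> u w [].
apply: eq_card => -[u v]; rewrite inE inE legal_moveE /=.
apply/andP/imsetP => [[/and3P[/eqP vE /forallP free _] /eqP[pE qE]]|].
  exists u; last by rewrite -qE -vE.
  rewrite inE; apply/familyP => i; rewrite /ready.
  case: ifP => [lt_ik|_]; first by have := implyP (free i) lt_ik; rewrite pE qE.
  by case: eqP => [->|//]; rewrite inE pE.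
case=> w; rewrite inE => /familyP rdy [-> ->].
have wk : w k = p by have := rdy k; rewrite /ready ltnn eqxx => /eqP.
rewrite !ffunE eqxx wk !eqxx arc andbT; split=> //.
apply/forallP => e; apply/implyP => lt_ek.
by have := rdy e; rewrite /ready lt_ek.
Qed.

Theorem theorem2 (n m : nat) (hm : (3 <= m)%N) (D : digraph 'I_m) :
  #|arcs (hanoi_graph n D)| = (\sum_(k < n) disc_arcs D k)%N /\
  (\sum_(k < n) disc_arcs D k)%N%:R =
    1 / 2 * #|arcs D|%:R * (m%:R ^+ n - (m%:R - 2) ^+ n) :> rat.
Proof.
split; first exact: card_hanoi_arcs.
have le2m : (2 <= m)%N by apply: ltnW.
rewrite natr_sum subrXX subKr mulrA [1 / 2 * _]mulrC -[_ * 2]mulrA.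
rewrite mul1r mulVf // mulr1 mulr_sumr; apply: eq_bigr => k _.
rewrite card_disc_arcs !natrM !natrX (natrB _ le2m).
by rewrite [X in _ * X = _]mulrC subnS predn_sub.
Qed.
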